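(* For every positive integer $k$, the graph $\overline{K_2+C_{2k+1}}$ is a spherical uniform disk graph but not a unit disk graph.
   Context: $K_t$ is the complete graph and $C_t$ the cycle on $t$ vertices; $G+H$ denotes the disjoint union of vertex-disjoint graphs, and $\overline{G}$ the complement of $G$. The intersection graph of a collection of objects has the objects as vertices, two distinct objects adjacent iff they intersect. A unit disk graph is the intersection graph of a finite collection of closed disks of a common radius in the Euclidean plane. On the unit sphere $\mathbb{S}^2\subset\mathbb{R}^3$ with spherical distance $d_{\mathbb{S}^2}(a,b)$ (the angle between vectors $a$ and $b$), the spherical disk of radius $r\in(0,\pi)$ centered at $v$ is $\{u\in\mathbb{S}^2: d_{\mathbb{S}^2}(u,v)\le r\}$. A spherical uniform disk graph is a graph which, for some $r\in(0,\pi)$, is the intersection graph of a finite collection of spherical disks all of radius $r$. *)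

(* Defs.v *)
From HB Require Import structures.
From mathcomp Require Import all_boot all_order all_algebra.
From mathcomp Require Import all_classical all_reals all_analysis.

Set Implicit Arguments.
Unset Strict Implicit.
Unset Printing Implicit Defensive.

Import Order.TTheory GRing.Theory Num.Theory.

Local Open Scope classical_set_scope.
Local Open Scope ring_scope.

Record sgraph := SGraph {
  svertex :> finType;
  sedge : rel svertex;
  sedge_sym : symmetric sedge;
  sedge_irrefl : irreflexive sedge }.

Section ConcreteGraphs.

Definition complete_rel (t : nat) : rel 'I_t := fun i j => i != j.

Lemma complete_sym t : symmetric (@complete_rel t).
Proof. by move=> i j; rewrite /complete_rel eq_sym. Qed.

Lemma complete_irrefl t : irreflexive (@complete_rel t).
Proof. by move=> i; rewrite /complete_rel eqxx. Qed.

Definition complete_graph (t : nat) : sgraph :=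
  SGraph (@complete_sym t) (@complete_irrefl t).

(* [ordS] is the cyclic successor i |-> i + 1 mod t; this is the usual cycle
   C_t for t >= 3. *)
Definition cycle_rel (t : nat) : rel 'I_t :=
  fun i j => (i != j) && ((j == ordS i) || (i == ordS j)).

Lemma cycle_sym t : symmetric (@cycle_rel t).
Proof. by move=> i j; rewrite /cycle_rel eq_sym orbC. Qed.

Lemma cycle_irrefl t : irreflexive (@cycle_rel t).
Proof. by move=> i; rewrite /cycle_rel eqxx. Qed.

Definition cycle_graph (t : nat) : sgraph :=
  SGraph (@cycle_sym t) (@cycle_irrefl t).

Variables G H : sgraph.

Definition disjoint_union_rel : rel (G + H)%type := fun x y =>
  match x, y with
  | inl a, inl b => sedge a b
  | inr a, inr b => sedge a b
  | _, _ => false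
  end.

Lemma disjoint_union_sym : symmetric disjoint_union_rel.
Proof. by move=> [a|a] [b|b] //=; rewrite sedge_sym. Qed.

Lemma disjoint_union_irrefl : irreflexive disjoint_union_rel.
Proof. by move=> [a|a] /=; rewrite sedge_irrefl. Qed.

Definition disjoint_union : sgraph :=
  SGraph disjoint_union_sym disjoint_union_irrefl.

Definition complement_rel : rel G := fun x y => (x != y) && ~~ sedge x y.

Lemma complement_sym : symmetric complement_rel.
Proof. by move=> x y; rewrite /complement_rel eq_sym sedge_sym. Qed.

Lemma complement_irrefl : irreflexive complement_rel.
Proof. by move=> x; rewrite /complement_rel eqxx. Qed.

Definition complement : sgraph := SGraph complement_sym complement_irrefl.

End ConcreteGraphs.

(* G is (isomorphic to) the intersection graph of the finite collection
   { D x | x in G }.  Since the vertices of an intersection graph are the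
   objects themselves, distinct vertices stand for distinct objects. *)
Definition is_intersection_graph (X : Type) (G : sgraph) (D : G -> set X) :=
  injective D /\
  forall x y : G, x != y -> (sedge x y <-> D x `&` D y !=set0).

Section Disks.
Variable R : realType.

Definition dot n (u v : 'rV[R]_n) : R := \sum_(i < n) u ord0 i * v ord0 i.

(* The library norm on 'rV[R]_n is the max norm, hence this definition. *)
Definition euclidean_norm n (u : 'rV[R]_n) : R := Num.sqrt (dot u u).

Definition closed_disk (c : 'rV[R]_2) (r : R) : set 'rV[R]_2 :=
  [set p | euclidean_norm (p - c) <= r].

Definition unit_disk_graph (G : sgraph) : Prop :=
  exists (r : R) (c : G -> 'rV[R]_2),
    0 < r /\ is_intersection_graph (fun x : G => closed_disk (c x) r).

Definition sphere2 : set 'rV[R]_3 := [set u | euclidean_norm u = 1].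

Definition angle n (u v : 'rV[R]_n) : R :=
  acos (dot u v / (euclidean_norm u * euclidean_norm v)).

Definition spherical_disk (v : 'rV[R]_3) (r : R) : set 'rV[R]_3 :=
  [set u | sphere2 u /\ angle u v <= r].

Definition spherical_uniform_disk_graph (G : sgraph) : Prop :=
  exists (r : R) (v : G -> 'rV[R]_3),
    [/\ 0 < r < pi, forall x, sphere2 (v x) &
        is_intersection_graph (fun x : G => spherical_disk (v x) r)].

End Disks.

(* Main.v *)
(* Both disk intersections amount to thresholds: two closed disks of radius [r]
   meet iff their centers are at distance at most [2r], and two spherical disks
   of radius [r < pi / 2] meet iff the dot product of their centers is at least
   [cos (2r)].

   On the sphere, put [K_2] at the poles and [C_(2k+1)] on the equator as the
   star polygon {2k+1/k}: antipodal poles and consecutive star vertices are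
   the farthest pairs.

   In the plane, let [a, b] be the two vertices of [K_2].  For every edge of the
   cycle, the segment between its centers must cross the line [ab], since
   otherwise one of the four remaining distances would be too large.  Hence the
   sides of [ab] give a proper 2-colouring of an odd cycle. *)
Require Import Defs.
From mathcomp Require Import all_boot all_order all_algebra.
From mathcomp Require Import all_classical all_reals all_analysis.
From mathcomp Require Import ring lra zify.

Set Implicit Arguments.
Unset Strict Implicit.

Import Order.TTheory GRing.Theory Num.Theory.
Local Open Scope classical_set_scope.
Local Open Scope ring_scope.

(** * Bilinearity and positivity of the dot product *)

Lemma dotC (R : realType) n (u v : 'rV[R]_n) : dot u v = dot v u.
Proof. by apply: eq_bigr => i _; rewrite mulrC. Qed.

Lemma dotDl (R : realType) n (u v w : 'rV[R]_n) :
  dot (u + v) w = dot u w + dot v w.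
Proof. by rewrite -big_split; apply: eq_bigr => i _ /=; rewrite mxE mulrDl. Qed.

Lemma dotZl (R : realType) n a (u v : 'rV[R]_n) : dot (a *: u) v = a * dot u v.
Proof. by rewrite mulr_sumr; apply: eq_bigr => i _ /=; rewrite mxE mulrA. Qed.

Lemma dotDr (R : realType) n (u v w : 'rV[R]_n) :
  dot w (u + v) = dot w u + dot w v.
Proof. by rewrite dotC dotDl !(dotC w). Qed.

Lemma dotZr (R : realType) n a (u v : 'rV[R]_n) : dot u (a *: v) = a * dot u v.
Proof. by rewrite dotC dotZl dotC. Qed.

Lemma dotNl (R : realType) n (u v : 'rV[R]_n) : dot (- u) v = - dot u v.
Proof. by rewrite -scaleN1r dotZl mulN1r. Qed.

Lemma dotNr (R : realType) n (u v : 'rV[R]_n) : dot u (- v) = - dot u v.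
Proof. by rewrite dotC dotNl dotC. Qed.

Lemma dot_ge0 (R : realType) n (u : 'rV[R]_n) : 0 <= dot u u.
Proof. by apply: sumr_ge0 => i _; rewrite -expr2 sqr_ge0. Qed.

Lemma dot_eq0 (R : realType) n (u : 'rV[R]_n) : (dot u u == 0) = (u == 0).
Proof.
apply/eqP/eqP => [/eqP|->]; last by apply: big1 => i _; rewrite mxE mul0r.
rewrite psumr_eq0 => [/allP u0|i _]; last by rewrite -expr2 sqr_ge0.
apply/rowP => i; rewrite mxE; apply/eqP.
by have := u0 i (mem_index_enum _); rewrite mulf_eq0 orbb.
Qed.

(** * Disks and segments in the plane *)

Lemma dot2E (R : realType) (u v : 'rV[R]_2) :
  dot u v = u 0 0 * v 0 0 + u 0 1 * v 0 1.
Proof.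
rewrite /dot !big_ord_recl big_ord0 addr0.
by congr (_ + _ * _); congr (_ _ _); apply/val_inj.
Qed.

Lemma dot_le_sqr (R : realType) n (u : 'rV[R]_n) r :
  0 <= r -> (euclidean_norm u <= r) = (dot u u <= r ^+ 2).
Proof.
move=> r0; rewrite -(ler_sqr (x := euclidean_norm u)) ?nnegrE ?sqrtr_ge0//.
by rewrite sqr_sqrtr// dot_ge0.
Qed.

(** A common point bounds the distance by the parallelogram law; conversely the midpoint of the
    centers lies in both disks. *)
Lemma closed_disk_meet (R : realType) (c c' : 'rV[R]_2) r : 0 < r ->
  closed_disk c r `&` closed_disk c' r !=set0 <->
  dot (c - c') (c - c') <= (2 * r) ^+ 2.
Proof.
move=> r0; have r0' := ltW r0; split => [[p []]|cc'].
  rewrite /closed_disk /= !dot_le_sqr// => pc pc'.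
  have := dot_ge0 ((p - c) + (p - c')).
  move: pc pc'; rewrite !(dotNl, dotNr, dotDl, dotDr).
  by rewrite !(dotC c p) !(dotC c' p) !(dotC c' c); nra.
exists (2^-1 *: (c + c')); split; rewrite /closed_disk /= dot_le_sqr//;
  move: cc'; rewrite !(dotNl, dotNr, dotZl, dotZr, dotDl, dotDr) !(dotC c' c); nra.
Qed.

(** Planar determinant: its sign tells on which side of the line along [u] the vector [v] lies. *)
Definition cross (R : realType) (u v : 'rV[R]_2) : R :=
  u 0 0 * v 0 1 - u 0 1 * v 0 0.

(* In coordinates along [q - p], scaled by its length, [u] and [v] project into
   the segment [[p, q]].  If they are on the same side of it, pushing the one
   closer to the line onto the line, and then to one end of the segment, does
   not decrease their distance, which ends up at most [rho]. *)
Lemma crossing_segments (R : realType) (p q u v : 'rV[R]_2) (rho : R) :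
  rho < dot (p - q) (p - q) -> rho < dot (u - v) (u - v) ->
  dot (p - u) (p - u) <= rho -> dot (p - v) (p - v) <= rho ->
  dot (q - u) (q - u) <= rho -> dot (q - v) (q - v) <= rho ->
  cross (q - p) (u - p) * cross (q - p) (v - p) < 0.
Proof.
rewrite !dot2E /cross !mxE => hpq huv hpu hpv hqu hqv.
rewrite ltNge; apply/negP => YY.
set e0 := q 0 0 - p 0 0 in YY; set e1 := q 0 1 - p 0 1 in YY.
pose L := e0 ^+ 2 + e1 ^+ 2.
pose X := e0 * (u 0 0 - p 0 0) + e1 * (u 0 1 - p 0 1).
pose X' := e0 * (v 0 0 - p 0 0) + e1 * (v 0 1 - p 0 1).
set Y := _ - _ in YY; set Y' := (X in _ * X) in YY.
have hL : rho < L by rewrite /L /e0 /e1; lra.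
have rho0 : 0 <= rho by apply: le_trans hpu; rewrite -!expr2 addr_ge0 ?sqr_ge0.
have L0 : 0 < L by lra.
have h1 : X ^+ 2 + Y ^+ 2 <= rho * L.
  by rewrite /X /Y /L; apply: le_trans (ler_wpM2r (ltW L0) hpu); rewrite /L; lra.
have h2 : X' ^+ 2 + Y' ^+ 2 <= rho * L.
  by rewrite /X' /Y'; apply: le_trans (ler_wpM2r (ltW L0) hpv); rewrite /L; lra.
have h3 : (X - L) ^+ 2 + Y ^+ 2 <= rho * L.
  by apply: le_trans (ler_wpM2r (ltW L0) hqu); rewrite /X /Y /L /e0 /e1; lra.
have h4 : (X' - L) ^+ 2 + Y' ^+ 2 <= rho * L.
  by apply: le_trans (ler_wpM2r (ltW L0) hqv); rewrite /X' /Y' /L /e0 /e1; lra.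
have h5 : rho * L < (X - X') ^+ 2 + (Y - Y') ^+ 2.
  move: huv; rewrite -(ltr_pM2r L0) => /lt_le_trans; apply.
  by rewrite /X /X' /Y /Y' /L; lra.
clearbody X X' Y Y' L; clear e0 e1 hpq huv hpu hpv hqu hqv.
have rL : rho * L < L ^+ 2 by nra.
(* [X ^+ 2 < L ^+ 2] gives [X < L], and [(X - L) ^+ 2 < L ^+ 2] gives [0 < X]. *)
have Xb : 0 < X < L by apply/andP; split; nra.
have Xb' : 0 < X' < L by apply/andP; split; nra.
case/andP: Xb => ? ?; case/andP: Xb' => ? ?.
have Z : (X - X') ^+ 2 <= X ^+ 2 \/ (X - X') ^+ 2 <= (X - L) ^+ 2.
  by case: (lerP X' X) => ?; [left|right]; nra.
have Z' : (X - X') ^+ 2 <= X' ^+ 2 \/ (X - X') ^+ 2 <= (X' - L) ^+ 2.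
  by case: (lerP X X') => ?; [left|right]; nra.
(* Since [Y * Y'] is nonnegative, the larger square bounds [(Y - Y') ^+ 2]; the matching bound from
   [Z] or [Z'] then contradicts [h5]. *)
have W : (Y - Y') ^+ 2 <= Y ^+ 2 \/ (Y - Y') ^+ 2 <= Y' ^+ 2.
  by case: (lerP (Y' ^+ 2) (Y ^+ 2)) => ?; [left|right]; nra.
by case: Z; case: Z'; case: W; lra.
Qed.

(** * Odd cycles and the planar obstruction *)

(** Alternation from 0 gives [s] the same value at 0 and at the even index [2 * k], whose successor
    is 0. *)
Lemma odd_cycle_not_bipartite k (s : 'I_(2 * k + 1) -> bool) :
  ~ (forall i, s (ordS i) = ~~ s i).
Proof.
move=> sS; have k0 : (0 < 2 * k + 1)%N by rewrite addn1.
have alt j (jk : (j < 2 * k + 1)%N) : s (Ordinal jk) = s (Ordinal k0) (+) odd j.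
  elim: j jk => [|j IH] jk.
    by rewrite addbF; congr s; apply: val_inj.
  have -> : Ordinal jk = ordS (Ordinal (ltnW jk)).
    by apply: val_inj; rewrite /= modn_small.
  by rewrite sS IH /= addbN.
have lt2k : (2 * k < 2 * k + 1)%N by rewrite addn1.
have := sS (Ordinal lt2k).
have -> : ordS (Ordinal lt2k) = Ordinal k0.
  by apply: val_inj; rewrite /= -addn1 modnn.
by rewrite [s (Ordinal lt2k)]alt oddM addbF; case: (s _).
Qed.

Lemma cycle_rel_ordS t (i : 'I_t) : (1 < t)%N -> cycle_rel i (ordS i).
Proof.
move=> t1; rewrite /cycle_rel eqxx andbT; apply/negP => /eqP/(congr1 val) /= ii.
have := ltn_ord i; rewrite leq_eqVlt => /orP[/eqP it|lt_it].
  by move: ii; rewrite it modnn => i0; move: it t1; rewrite i0 => <-.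
by move: ii; rewrite modn_small// => /eqP; rewrite -[X in X == _]addn0 -addn1 eqn_add2l.
Qed.

Lemma not_unit_disk_graph (R : realType) (k : nat) : (0 < k)%N ->
  ~ unit_disk_graph R (complement
      (disjoint_union (complete_graph 2) (cycle_graph (2 * k + 1)))).
Proof.
move=> k0 [r [c [r0 [_ cE]]]].
pose rho := (2 * r) ^+ 2.
have edgeE x y : x != y ->
    sedge x y = (dot (c x - c y) (c x - c y) <= rho).
  move=> xy; have xyE := iff_trans (cE x y xy) (closed_disk_meet _ _ r0).
  by apply/idP/idP => h; apply/xyE.
have near x y : sedge x y -> dot (c x - c y) (c x - c y) <= rho.
  by move=> e; rewrite -edgeE//; apply: contraTneq e => ->; rewrite sedge_irrefl.
have far x y : x != y -> ~~ sedge x y ->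
    rho < dot (c x - c y) (c x - c y).
  by move=> xy; rewrite edgeE// -ltNge.
pose a : complete_graph 2 := ord0; pose b : complete_graph 2 := ord_max.
pose s i := cross (c (inl b) - c (inl a)) (c (inr i) - c (inl a)) > 0.
apply: (@odd_cycle_not_bipartite k s) => i.
have ci : cycle_rel i (ordS i) by apply: cycle_rel_ordS; lia.
have ii : i != ordS i by case/andP: ci.
have : cross (c (inl b) - c (inl a)) (c (inr i) - c (inl a)) *
       cross (c (inl b) - c (inl a)) (c (inr (ordS i)) - c (inl a)) < 0.
  (* The pairs [a], [b] and [i], [ordS i] are non-adjacent in the complement; the four mixed pairs
     are adjacent. *)
  apply: (@crossing_segments _ _ _ _ _ rho); try exact: near; apply: far => //.
  by rewrite /= /complement_rel /= ci andbF.
rewrite /s; set x := cross _ _; set y := cross _ _ => xy.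
by case: (ltrP 0 x); case: (ltrP 0 y) => //; nra.
Qed.

(** * Spherical disks as dot-product thresholds *)

Lemma dot3E (R : realType) (u v : 'rV[R]_3) :
  dot u v = u 0 ord0 * v 0 ord0 + u 0 1 * v 0 1 + u 0 ord_max * v 0 ord_max.
Proof.
rewrite /dot !big_ord_recl big_ord0 addr0 addrA.
by do 2?[congr (_ + _)]; congr (_ * _); congr (_ _ _); apply/val_inj.
Qed.

Lemma unit_orthogonal (R : realType) (v : 'rV[R]_3) :
  exists2 w, dot w w = 1 & dot v w = 0.
Proof.
(* On the third axis a horizontal basis vector works; otherwise turn the horizontal projection of
   [v] by a right angle and normalize. *)
have [/eqP v0|v0] := boolP (v 0 ord0 ^+ 2 + v 0 1 ^+ 2 == 0).
  exists (delta_mx 0 ord0); rewrite dot3E !mxE //=; first by ring.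
  nra.
pose w : 'rV[R]_3 := \row_j (if j == ord0 then v 0 1 else
  if j == 1 then - v 0 ord0 else 0).
exists ((Num.sqrt (v 0 ord0 ^+ 2 + v 0 1 ^+ 2))^-1 *: w).
  rewrite dotZl dotZr mulrA -expr2 exprVn sqr_sqrtr; last by nra.
  by rewrite dot3E !mxE /=; field.
by rewrite dotZr dot3E !mxE /=; ring.
Qed.

Lemma dot_unit_le1 (R : realType) n (u v : 'rV[R]_n) :
  dot u u = 1 -> dot v v = 1 -> -1 <= dot u v <= 1.
Proof.
move=> u1 v1; have := dot_ge0 (u - v); have := dot_ge0 (u + v).
rewrite !(dotNl, dotNr, dotDl, dotDr) (dotC v u) u1 v1; lra.
Qed.

Lemma dot_unit_inj (R : realType) n (u v : 'rV[R]_n) :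
  dot u u = 1 -> dot v v = 1 -> 1 <= dot u v -> u = v.
Proof.
move=> u1 v1 uv; apply/eqP; rewrite -subr_eq0 -dot_eq0.
rewrite eq_le dot_ge0 andbT !(dotDl, dotDr, dotNl, dotNr) (dotC v u) u1 v1; lra.
Qed.

Lemma sphere2E (R : realType) (u : 'rV[R]_3) : sphere2 u <-> dot u u = 1.
Proof.
rewrite /sphere2 /= /euclidean_norm; split => [u1|->]; last exact: sqrtr1.
by rewrite -(sqr_sqrtr (dot_ge0 u)) u1 expr1n.
Qed.

(** Cosine is decreasing on [[0, pi]], so the angular bound becomes a half-space condition. *)
Lemma spherical_diskE (R : realType) (v u : 'rV[R]_3) s : -1 <= s <= 1 ->
  dot v v = 1 -> spherical_disk v (acos s) u <-> dot u u = 1 /\ s <= dot u v.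
Proof.
move=> s1 v1; rewrite /spherical_disk /= sphere2E.
suff E : dot u u = 1 -> (angle u v <= acos s) = (s <= dot u v).
  by split=> -[u1]; rewrite E.
move=> u1; rewrite /angle /euclidean_norm u1 v1 sqrtr1 mulr1 divr1.
have uv1 := dot_unit_le1 u1 v1.
rewrite leNgt -ltr_cos ?in_itv /= ?acos_ge0 ?acos_lepi//.
by rewrite !acosK ?in_itv//= -leNgt.
Qed.

Lemma spherical_disk_inj (R : realType) (v v' : 'rV[R]_3) (s : R) : 0 < s < 1 ->
  dot v v = 1 -> dot v' v' = 1 ->
  spherical_disk v (acos s) = spherical_disk v' (acos s) -> v = v'.
Proof.
move=> s1 v1 v1' vv'; apply: dot_unit_inj => //.
have s1' : -1 <= s <= 1 by lra.
have [w w1 vw] := unit_orthogonal v.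
pose t := Num.sqrt (1 - s ^+ 2).
have tE : t ^+ 2 = 1 - s ^+ 2 by rewrite sqr_sqrtr//; nra.
(* Points [s v + t w] and [s v - t w] are both on the boundary of the first disk;
   averaging the conditions that they are in the second gives [s <= s (v . v')]. *)
have in_disk e : e ^+ 2 = 1 -> s <= s * dot v v' + e * t * dot w v'.
  move=> e1; rewrite -!dotZl -dotDl.
  suff : spherical_disk v' (acos s) (s *: v + (e * t) *: w).
    by rewrite spherical_diskE// => -[].
  rewrite -vv' spherical_diskE// !(dotDl, dotDr, dotZl, dotZr) (dotC w v).
  by rewrite v1 w1 vw; nra.
have eN : (-1) ^+ 2 = 1 :> R by rewrite sqrrN expr1n.
have := in_disk 1 (expr1n _ _); have := in_disk (-1) eN; nra.
Qed.

(** The threshold is [cos (2 * acos s)]. For a common point [u], expand the squared norm of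
    [v + v' - (2 * s) *: u]; conversely, [v + v'] normalized lies in both disks. *)
Lemma spherical_disk_meet (R : realType) (v v' : 'rV[R]_3) s : 0 < s < 1 ->
  dot v v = 1 -> dot v' v' = 1 ->
  spherical_disk v (acos s) `&` spherical_disk v' (acos s) !=set0 <->
  2 * s ^+ 2 - 1 <= dot v v'.
Proof.
move=> s1 v1 v1'; have s1' : -1 <= s <= 1 by lra.
split=> [[u []]|vv'].
  rewrite !spherical_diskE// => -[u1 uv] [_ uv'].
  have := dot_ge0 (v + v' - (2 * s) *: u).
  rewrite !(dotNl, dotNr, dotDl, dotDr, dotZl, dotZr).
  rewrite u1 v1 v1' (dotC v u) (dotC v' u) (dotC v' v); nra.
pose l := Num.sqrt (2 + 2 * dot v v').
have lE : l ^+ 2 = 2 + 2 * dot v v' by rewrite sqr_sqrtr//; nra.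
have l0 : 0 < l by rewrite sqrtr_gt0; nra.
have sl : 2 * s <= l.
  by rewrite -ler_sqr ?nnegrE ?(ltW l0)//; nra.
have sl' : s <= l^-1 * (1 + dot v v').
  by rewrite mulrC ler_pdivlMr//; nra.
exists (l^-1 *: (v + v')); rewrite /= /setI /=.
rewrite !spherical_diskE// !(dotDl, dotDr, dotZl, dotZr) (dotC v' v) v1 v1'.
have E : l^-1 * (l^-1 * (1 + dot v v' + (dot v v' + 1))) = 1.
  have -> : 1 + dot v v' + (dot v v' + 1) = l ^+ 2 by rewrite lE; ring.
  by field; rewrite gt_eqF.
by rewrite -mulrDr E [dot v v' + 1]addrC.
Qed.

Lemma spherical_uniform_disk_graph_dot (R : realType) (G : sgraph) (c : R)
    (v : G -> 'rV[R]_3) :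
  -1 < c < 1 -> (forall x, dot (v x) (v x) = 1) -> injective v ->
  (forall x y, x != y -> sedge x y = (c <= dot (v x) (v y))) ->
  spherical_uniform_disk_graph R G.
Proof.
(* Half-angle formula: [2 * s ^+ 2 - 1 = c]. *)
move=> c1 v1 vI vE; pose s := Num.sqrt ((1 + c) / 2).
have sE : s ^+ 2 = (1 + c) / 2 by rewrite sqr_sqrtr//; lra.
have s0 : 0 < s by rewrite sqrtr_gt0; lra.
have s1 : 0 < s < 1 by nra.
exists (acos s), v; split.
- by rewrite acos_gt0 ?acos_ltpi//; lra.
- by move=> x; apply/sphere2E.
split=> [x y /(spherical_disk_inj s1 (v1 x) (v1 y))/vI//|x y xy].
rewrite vE// spherical_disk_meet// sE.
by have -> : 2 * ((1 + c) / 2) - 1 = c by field.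
Qed.

(** * The star polygon on the equator *)

Lemma ltr_cos_frac (R : realType) (N m n : nat) : (m < n <= N)%N ->
  cos (n%:R * (pi / N%:R)) < cos (m%:R * (pi / N%:R)) :> R.
Proof.
move=> /andP[mn nN]; have N0 : 0 < N%:R :> R by rewrite ltr0n; lia.
have bound p : (p <= N)%N -> p%:R * (pi / N%:R) \in `[0, pi : R].
  move=> pN; rewrite in_itv /= mulr_ge0 ?divr_ge0 ?pi_ge0//=.
  by rewrite mulrCA ler_piMr ?pi_ge0// ler_pdivrMr// mul1r ler_nat.
rewrite ltr_cos ?bound//; last lia.
by rewrite ltr_pM2r ?ltr_nat// divr_gt0// pi_gt0.
Qed.

Section StarPolygon.
Context (R : realType) (k : nat) (k0 : (0 < k)%N).

Definition cos_step (m : nat) : R := cos (m%:R * (pi / (2 * k + 1)%:R)).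

(* Poles and equator have dot product [0]; [- cos_step 2] lies below the dot
   product of non-consecutive star vertices but exceeds [0] when [k = 1]. *)
Definition star_threshold : R := Num.min 0 (- cos_step 2).

(* Vertex [i] of the regular star polygon [{2k+1/k}]. *)
Definition star_angle (i : nat) : R :=
  i%:R * ((2 * k)%:R * (pi / (2 * k + 1)%:R)).

Let N0 : (2 * k + 1)%:R != 0 :> R.
Proof. by rewrite pnatr_eq0 addn1. Qed.

Lemma cos_stepC m : (m <= 2 * k + 1)%N ->
  cos_step (2 * k + 1 - m) = - cos_step m.
Proof.
move=> mN; rewrite /cos_step natrB// mulrBl mulrCA mulfV// mulr1.
by rewrite addrC cosDpi cosN.
Qed.

(** Each step of the star turns by [pi - pi / (2 * k + 1)]. *)
Lemma cos_star_angle m : cos (star_angle m) = (-1) ^+ m * cos_step m.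
Proof.
have -> : star_angle m = - (m%:R * (pi / (2 * k + 1)%:R)) + pi *+ m.
  move: N0; rewrite /star_angle natrD -[pi *+ m]mulr_natl => N0'; field.
  by [].
by rewrite (alternatingn (@cosDpi R)) cosN.
Qed.

(** Consecutive star vertices get [n = 1] and all other pairs [n >= 3], which leaves room for a
    threshold at 2. For even [m], take [n = 2 * k + 1 - m]. *)
Lemma cos_star_angle_odd m : (0 < m < 2 * k + 1)%N -> exists n,
  [/\ odd n, (n < 2 * k + 1)%N, (n == 1%N) = (m == 1%N) || (m == (2 * k)%N) &
      cos (star_angle m) = - cos_step n].
Proof.
move=> /andP[m0 mN]; rewrite cos_star_angle -signr_odd.
have [mo|me] := boolP (odd m).
  by exists m; split => //; [lia|rewrite expr1 mulN1r].
exists (2 * k + 1 - m)%N; split; [lia|lia|lia|].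
by rewrite cos_stepC ?(ltnW mN)// opprK expr0 mul1r.
Qed.

Lemma star_threshold_bounds : -1 < star_threshold < 1.
Proof.
have : cos_step 2 < cos_step 0 by apply: ltr_cos_frac; lia.
rewrite /star_threshold [cos_step 0]/cos_step mul0r cos0 => c1.
by rewrite lt_min gt_min; apply/andP; split; [apply/andP; split|]; lra.
Qed.

Lemma cos_star_angle_lt1 m : (0 < m < 2 * k + 1)%N -> cos (star_angle m) < 1.
Proof.
move=> /cos_star_angle_odd[n [_ nN _ ->]].
have : cos_step (2 * k + 1) < cos_step n by apply: ltr_cos_frac; lia.
rewrite -[X in cos_step X]subn0 cos_stepC// [cos_step 0]/cos_step mul0r cos0; lra.
Qed.

Lemma star_thresholdE m : (0 < m < 2 * k + 1)%N ->
  (star_threshold <= cos (star_angle m)) =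
  ~~ ((m == 1%N) || (m == (2 * k)%N)).
Proof.
move=> /cos_star_angle_odd[n [no nN <- ->]]; rewrite /star_threshold.
have [->|n1] := eqVneq n 1%N; rewrite /= ?ge_min.
  apply/negbTE; rewrite negb_or -!ltNge.
  have c12 : cos_step 2 < cos_step 1 by apply: ltr_cos_frac; lia.
  (* The left side equals [- cos_step 1], so [cos_step 1] is positive. *)
  have : cos_step (2 * k + 1 - 1) < cos_step 1 by apply: ltr_cos_frac; lia.
  by rewrite cos_stepC; [move=> ?; apply/andP; split; lra|lia].
apply/orP; right; rewrite lerN2 ltW// ltr_cos_frac//.
by rewrite (ltnW nN) andbT; case: n no n1 {nN} => [|[|[|]]].
Qed.

Definition row3 (x y z : R) : 'rV[R]_3 := \row_j [:: x; y; z]`_j.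

Lemma dot_row3 x y z x' y' z' :
  dot (row3 x y z) (row3 x' y' z') = x * x' + y * y' + z * z'.
Proof. by rewrite dot3E !mxE. Qed.

Definition star_center
    (x : disjoint_union (complete_graph 2) (cycle_graph (2 * k + 1))) :=
  match x with
  | inl i => row3 0 0 ((-1) ^+ i)
  | inr i => row3 (cos (star_angle i)) (sin (star_angle i)) 0
  end.

Lemma star_center_unit x : dot (star_center x) (star_center x) = 1.
Proof.
case: x => i; rewrite dot_row3 ?mulr0 ?addr0 ?add0r -!expr2.
  by rewrite sqrr_sign.
exact: cos2Dsin2.
Qed.

Lemma dot_poles (i j : 'I_2) : i != j ->
  dot (star_center (inl i)) (star_center (inl j)) = -1.
Proof.
rewrite dot_row3 !mulr0 !add0r.
by case: i j => [[|[|//]] ?] [[|[|//]] ?] //= _; rewrite ?expr0 ?mul1r ?mulr1.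
Qed.

Lemma dot_pole_equator i j :
  dot (star_center (inl i)) (star_center (inr j)) = 0.
Proof. by rewrite dot_row3; ring. Qed.

Lemma dot_equator (i j : 'I_(2 * k + 1)) : (i <= j)%N ->
  dot (star_center (inr i)) (star_center (inr j)) = cos (star_angle (j - i)).
Proof.
move=> ij; rewrite dot_row3 mulr0 addr0 /star_angle natrB// mulrBl cosB.
by rewrite [X in _ = X + _]mulrC [X in _ = _ + X]mulrC.
Qed.

(** Only the successor of [j] can wrap around, namely from [2 * k] to 0; this closing edge has
    difference [2 * k]. *)
Lemma cycle_rel_lt (i j : 'I_(2 * k + 1)) : (i < j)%N ->
  cycle_rel i j = ((j - i)%N == 1%N) || ((j - i)%N == (2 * k)%N).
Proof.
move=> ij; have jN := ltn_ord j; rewrite /cycle_rel -!val_eqE /= (ltn_eqF ij) /=.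
rewrite (modn_small (_ : i.+1 < _)%N); last lia.
have [jk|jk] := eqVneq (j : nat) (2 * k)%N.
  have -> : (j.+1 %% (2 * k + 1) = 0)%N by rewrite jk -addn1 modnn.
  lia.
by rewrite modn_small; lia.
Qed.

Lemma spherical_uniform_disk_graph_star : spherical_uniform_disk_graph R
  (complement (disjoint_union (complete_graph 2) (cycle_graph (2 * k + 1)))).
Proof.
have eq_lt (P : 'I_(2 * k + 1) -> 'I_(2 * k + 1) -> Prop) :
    (forall i j, P i j -> P j i) -> (forall i j : 'I_(2 * k + 1), (i < j)%N -> P i j) ->
    forall i j, i != j -> P i j.
  by move=> PC Plt i j; rewrite neq_ltn => /orP[/Plt//|/Plt/PC].
have diff_bounds (i j : 'I_(2 * k + 1)) : (i < j)%N -> (0 < j - i < 2 * k + 1)%N.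
  by move=> ij; have := ltn_ord j; lia.
have center_lt1 x y : x != y -> dot (star_center x) (star_center y) < 1.
  case: x y => i [] j ij.
  - by rewrite dot_poles//; lra.
  - by rewrite dot_pole_equator ltr01.
  - by rewrite dotC dot_pole_equator ltr01.
  - apply: (eq_lt (fun i j => dot (star_center (inr i)) (star_center (inr j)) < 1)) ij.
      by move=> a b; rewrite dotC.
    by move=> a b ab; rewrite dot_equator ?(ltnW ab)// cos_star_angle_lt1 ?diff_bounds.
have threshold_le0 : star_threshold <= 0 by rewrite ge_min lexx.
apply: (@spherical_uniform_disk_graph_dot _ (complement _) star_threshold star_center).
- exact: star_threshold_bounds.
- exact: star_center_unit.
(* Equal centers would have dot product 1, excluded for distinct vertices. *)
- move=> x y xy; apply/eqP/negPn/negP => /center_lt1.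
  by rewrite xy star_center_unit ltxx.
move=> x y xy; rewrite [LHS]/= /complement_rel xy /=.
case: x y xy => i [] j ij /=.
- rewrite dot_poles// /complete_rel.
  have -> : i != j by [].
  by have := star_threshold_bounds; lra.
- by rewrite dot_pole_equator threshold_le0.
- by rewrite dotC dot_pole_equator threshold_le0.
apply: (eq_lt (fun i j => ~~ cycle_rel i j =
  (star_threshold <= dot (star_center (inr i)) (star_center (inr j))))) ij.
  by move=> a b; rewrite dotC -[cycle_rel a b]/(@sedge (cycle_graph _) a b) sedge_sym.
by move=> a b ab; rewrite dot_equator ?(ltnW ab)// star_thresholdE ?diff_bounds// cycle_rel_lt.
Qed.

End StarPolygon.

Theorem proposition3p14 (R : realType) (k : nat) (hk : (0 < k)%N) :
  let G := complement
    (disjoint_union (complete_graph 2) (cycle_graph (2 * k + 1))) in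
  spherical_uniform_disk_graph R G /\ ~ unit_disk_graph R G.
Proof.
by split; [exact: spherical_uniform_disk_graph_star|exact: not_unit_disk_graph].
Qed.
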